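(* Consider the sequence of binary classification problems indexed by $m$ described in the context, and suppose that $N=o(m)$, $n=o(m)$, and $m=o(\min\{N^2,Nn\})$ as $m\to\infty$. Then there exists a classifier $\phi$ whose generalized error exponent satisfies $J(\phi)>0$.
   Context: For each integer $m\ge1$ let $[m]=\{1,\dots,m\}$ be the alphabet. The sample sizes $N=N(m)$ and $n=n(m)$ are positive integers with $N,n\to\infty$ as $m\to\infty$. Fix constants $\varepsilon>0$ and $\bar c>0$ (a large positive constant). Let $\mathcal P_m$ be the set of pairs $(\pi,\mu)$ of probability distributions on $[m]$ with $\|\mu-\pi\|_1\ge\varepsilon$, $\max_j\pi_j\le \bar c/m$ and $\max_j\mu_j\le\bar c/m$. Two training sequences $X=(X_1,\dots,X_N)$ i.i.d. with marginal $\pi$ and $Y=(Y_1,\dots,Y_N)$ i.i.d. with marginal $\mu$, and a test sequence $Z=(Z_1,\dots,Z_n)$ i.i.d. with marginal $\nu$ are observed, the three sequences being independent; $\mathsf P_{(\pi,\mu,\nu)}$ denotes the corresponding probability. A classifier is a sequence $\phi=\{\phi_m\}$ of functions $\phi_m:[m]^N\times[m]^N\times[m]^n\to\{0,1\}$ (output $1$ means deciding that $Z$ comes from $\mu$). Its worst-case average probability of error is $$P_e(\phi_m)=\sup_{(\pi,\mu)\in\mathcal P_m}\Big[\tfrac12\mathsf P_{(\pi,\mu,\pi)}\{\phi_m=1\}+\tfrac12\mathsf P_{(\pi,\mu,\mu)}\{\phi_m=0\}\Big].$$ With the normalization $r(N,n,m)=\min\{N^2,Nn\}/m$, the generalized error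 exponent of $\phi$ is $$J(\phi)=-\limsup_{m\to\infty}\frac{1}{r(N,n,m)}\log P_e(\phi_m).$$ *)

(* Defs.v *)
From HB Require Import structures.
From mathcomp Require Import all_boot all_order all_algebra.
From mathcomp Require Import all_classical all_reals all_analysis.
Set Implicit Arguments. Unset Strict Implicit. Unset Printing Implicit Defensive.
Import Order.TTheory GRing.Theory Num.Theory.
Local Open Scope ring_scope.
Local Open Scope classical_set_scope.

(* Alphabet [m] = {1..m} is represented by 'I_m = {0..m-1}. *)
Section Defs.
Variable R : realType.

Definition is_dist (m : nat) (p : {ffun 'I_m -> R}) : Prop :=
  (forall j, 0 <= p j) /\ \sum_(j < m) p j = 1.

Definition admissible (eps cbar : R) (m : nat) (pi mu : {ffun 'I_m -> R}) : Prop :=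
  [/\ is_dist pi, is_dist mu,
      eps <= \sum_(j < m) `|mu j - pi j|,
      (forall j, pi j <= cbar / m%:R) &
      (forall j, mu j <= cbar / m%:R)].

Definition seqT (m k : nat) := {ffun 'I_k -> 'I_m}.

Definition pseq (m k : nat) (p : {ffun 'I_m -> R}) (s : seqT m k) : R :=
  \prod_(i < k) p (s i).

Definition prob_event (m NN nn : nat) (pi mu nu : {ffun 'I_m -> R})
  (A : seqT m NN -> seqT m NN -> seqT m nn -> bool) : R :=
  \sum_(x : seqT m NN) \sum_(y : seqT m NN) \sum_(z : seqT m nn)
     pseq pi x * pseq mu y * pseq nu z * (A x y z)%:R.

Definition classifier (N n : nat -> nat) :=
  forall m : nat, seqT m (N m) -> seqT m (N m) -> seqT m (n m) -> bool.

Definition avg_err (m NN nn : nat) (phim : seqT m NN -> seqT m NN -> seqT m nn -> bool)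
  (pi mu : {ffun 'I_m -> R}) : R :=
  2^-1 * prob_event pi mu pi phim
  + 2^-1 * prob_event pi mu mu (fun x y z => ~~ phim x y z).

Definition Pe (eps cbar : R) (N n : nat -> nat) (phi : classifier N n) (m : nat) : R :=
  sup [set e : R | exists pi mu : {ffun 'I_m -> R},
         admissible eps cbar pi mu /\ e = avg_err (phi m) pi mu].

Definition rate (N n : nat -> nat) (m : nat) : R :=
  (minn (N m ^ 2) (N m * n m))%:R / m%:R.

Definition elog (x : R) : \bar R := if x <= 0 then -oo%E else (ln x)%:E.

Definition J (eps cbar : R) (N n : nat -> nat) (phi : classifier N n) : \bar R :=
  (- limn_esup (fun m => elog (Pe eps cbar phi m) * ((rate N n m)^-1)%:E))%E.

End Defs.

(* Main.v *)
(* Let A and B be the sets of symbols occurring in the first halves of the two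
   training sequences, and f = 1_A - 1_B. The test compares the average of f over
   Z with the midpoint of its averages over the second halves of X and Y. Given f
   these are independent i.i.d. averages; f has at most N nonzero values, so f^2
   has mean O(N/m), and e^v <= 1 + v + 2 v^2 gives a conditional Chernoff bound
   with parameter theta = t min(N, n). The conditional drift <pi - mu, f> has mean
   of order N ||pi - mu||_2^2, hence at least of order N/m, because N = o(m) makes
   occurrence probabilities nearly linear. As a function of the first halves it
   has bounded differences O(1/m), and theta/m is small, so the bounded-difference
   martingale method controls its exponential moment. Altogether
   E exp(- theta statistic) <= exp(- c min(N^2, N n) / m). Occurrence rather than
   occurrence counts is essential: one symbol repeated many times would ruin the
   exponential moment. *)
Require Import Defs.
From HB Require Import structures.
From mathcomp Require Import all_boot all_order all_algebra.
From mathcomp Require Import all_classical all_reals all_analysis.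
From mathcomp Require Import zify ring lra.
Import Order.TTheory GRing.Theory Num.Theory.
Import numFieldNormedType.Exports.
Local Open Scope classical_set_scope.
Local Open Scope ring_scope.

Section SplitSampleTest.
Set Implicit Arguments.
Unset Strict Implicit.
Unset Printing Implicit Defensive.
Context {R : realType}.
Implicit Types (I T : finType).

(** * Finite expectations and i.i.d. product laws *)

Definition finite_dist T (p : T -> R) := (forall t, 0 <= p t) /\ \sum_t p t = 1.

Definition mean T (p : T -> R) (F : T -> R) : R := \sum_t p t * F t.

Definition prodw I T (p : T -> R) (x : {ffun I -> T}) : R := \prod_i p (x i).

(** Splicing two full sequences expresses independence of disjoint blocks of coordinates without
    splitting the index type [I]. *)
Definition mix I T (S : pred I) (x y : {ffun I -> T}) : {ffun I -> T} :=
  [ffun i => if S i then x i else y i].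

Lemma eq_mean T (p F G : T -> R) : F =1 G -> mean p F = mean p G.
Proof. by move=> FG; apply: eq_bigr => t _; rewrite FG. Qed.

Lemma le_mean T (p F G : T -> R) :
  finite_dist p -> (forall t, F t <= G t) -> mean p F <= mean p G.
Proof. by move=> [p0 _] FG; apply: ler_sum => t _; rewrite ler_wpM2l. Qed.

Lemma mean_cst T (p : T -> R) c : finite_dist p -> mean p (fun=> c) = c.
Proof. by move=> [_ p1]; rewrite /mean -mulr_suml p1 mul1r. Qed.

Lemma meanD T (p F G : T -> R) :
  mean p (fun t => F t + G t) = mean p F + mean p G.
Proof. by rewrite /mean -big_split; apply: eq_bigr => t _; rewrite mulrDr. Qed.

Lemma meanZl T (p F : T -> R) c : mean p (fun t => c * F t) = c * mean p F.
Proof. by rewrite /mean mulr_sumr; apply: eq_bigr => t _; rewrite mulrCA. Qed.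

Lemma meanB T (p F G : T -> R) :
  mean p (fun t => F t - G t) = mean p F - mean p G.
Proof.
rewrite -[- mean p G]mulN1r -meanZl -meanD.
by apply: eq_mean => t; rewrite mulN1r.
Qed.

Lemma mean_sum T (J : finType) (p : T -> R) (F : J -> T -> R) :
  mean p (fun t => \sum_j F j t) = \sum_j mean p (F j).
Proof. by rewrite /mean exchange_big; apply: eq_bigr => t _; rewrite mulr_sumr. Qed.

Lemma exchange_mean T T' (p : T -> R) (q : T' -> R) (F : T -> T' -> R) :
  mean p (fun t => mean q (F t)) = mean q (fun u => mean p (F^~ u)).
Proof.
rewrite /mean; under eq_bigr do rewrite mulr_sumr.
rewrite exchange_big; apply: eq_bigr => u _.
by rewrite mulr_sumr; apply: eq_bigr => t _; rewrite mulrCA.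
Qed.

Lemma mean_mul T1 T2 (p : T1 -> R) (q : T2 -> R) F G :
  mean p F * mean q G = mean p (fun x => mean q (fun y => F x * G y)).
Proof.
rewrite [LHS]mulrC -meanZl; apply: eq_mean => x.
by rewrite meanZl [RHS]mulrC.
Qed.

Lemma mean_mul3 T1 T2 T3 (p1 : T1 -> R) (p2 : T2 -> R) (p3 : T3 -> R) F1 F2 F3 :
  mean p1 F1 * (mean p2 F2 * mean p3 F3) =
  mean p1 (fun x => mean p2 (fun y => mean p3 (fun z => F1 x * (F2 y * F3 z)))).
Proof.
rewrite [mean p2 F2 * _]mean_mul mean_mul; apply: eq_mean => x.
by apply: eq_mean => y; rewrite [RHS]meanZl.
Qed.

Lemma mean_prod I T (p : T -> R) (h : I -> T -> R) :
  mean (prodw p) (fun x : {ffun I -> T} => \prod_i h i (x i)) =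
  \prod_i mean p (h i).
Proof.
rewrite /mean /prodw bigA_distr_bigA; apply: eq_bigr => x _.
by rewrite -big_split.
Qed.

Lemma prodw_dist I T (p : T -> R) :
  finite_dist p -> finite_dist (@prodw I T p).
Proof.
move=> [p0 p1]; split=> [x|]; first by apply: prodr_ge0.
have p1' : mean p (fun=> 1) = 1.
  by rewrite /mean; under eq_bigr do rewrite mulr1.
have := @mean_prod I T p (fun=> fun=> 1); rewrite [RHS]big1 // => <-.
by apply: eq_bigr => x _; rewrite /= big1 ?mulr1.
Qed.

Lemma sum_indicatorE T (F : T -> R) u :
  F u = \sum_s F s * (u == s)%:R.
Proof.
rewrite (bigD1 u) //= eqxx mulr1 big1 ?addr0 // => s.
by rewrite eq_sym => /negbTE ->; rewrite mulr0.
Qed.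

(** Expanding [F] in point indicators reduces the claim to a single sequence [s]. There the
    indicator is a product over coordinates, each factor depending on only one of [x] and [y], so
    [mean_prod] applies twice. *)
Lemma mean_mix I T (S : pred I) (p : T -> R) (F : {ffun I -> T} -> R) :
  finite_dist p ->
  mean (prodw p) (fun x => mean (prodw p) (fun y => F (mix S x y))) =
  mean (prodw p) F.
Proof.
move=> pd.
pose hx (s : {ffun I -> T}) i t : R := if S i then (t == s i)%:R else 1.
pose hy (s : {ffun I -> T}) i t : R := if S i then 1 else (t == s i)%:R.
have mixE (s x y : {ffun I -> T}) :
    (mix S x y == s)%:R = (\prod_i hx s i (x i)) * (\prod_i hy s i (y i)).
  rewrite -big_split /=; have [<-|ne] := eqVneq.
    by rewrite big1 // => i _; rewrite /hx /hy ffunE; case: (S i); rewrite eqxx mulr1.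
  suff [i ni] : exists i, mix S x y i != s i.
    rewrite (bigD1 i) //= /hx /hy; move: ni; rewrite ffunE.
    by case: (S i) => /negbTE ->; rewrite ?(mul0r, mulr0).
  apply/existsP; apply: contraNT ne => /existsPn e.
  by apply/eqP/ffunP => i; apply/eqP; have := e i; rewrite negbK.
transitivity (\sum_s F s * mean (prodw p) (fun x => mean (prodw p) (fun y =>
    (\prod_i hx s i (x i)) * (\prod_i hy s i (y i))))).
  under eq_mean => x.
    under eq_mean => y do
      [rewrite (sum_indicatorE F); under eq_bigr do rewrite mixE].
    rewrite mean_sum; over.
  rewrite mean_sum; apply: eq_bigr => s _.
  by rewrite -meanZl; apply: eq_mean => x; rewrite -meanZl.
apply: eq_bigr => s _; rewrite mulrC; congr (_ * _).
under eq_mean do rewrite meanZl mean_prod mulrC.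
rewrite meanZl mean_prod -big_split; apply: eq_bigr => i _ /=.
have point : mean p (fun t => (t == s i)%:R) = p (s i).
  by rewrite /mean (sum_indicatorE p); apply: eq_bigr => t _; rewrite eq_sym.
rewrite /hx /hy; case: (S i); rewrite mean_cst // point ?mul1r ?mulr1 //.
Qed.

(** Decoupling: the hypothesis on [F] says that its first argument matters only on [S] and its
    second only off [S]. One sequence used in both slots then acts like two independent copies. *)
Lemma mean_split I T (S : pred I) (p : T -> R) (F : {ffun I -> T} -> {ffun I -> T} -> R) :
  finite_dist p ->
  (forall x y, F (mix S x y) (mix S x y) = F x y) ->
  mean (prodw p) (fun x => F x x) =
  mean (prodw p) (fun x => mean (prodw p) (F x)).
Proof.
move=> pd Fm; rewrite -(mean_mix S) //.
by apply: eq_mean => x; apply: eq_mean => y; rewrite Fm.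
Qed.

(** * Exponential moments: bounded differences and i.i.d. averages *)

(** From [1 - v <= expR (- v)] one gets [expR v <= 1 / (1 - v)], and [(1 + v + 2 v^2) (1 - v) - 1 =
    v^2 (1 - 2 v)]. *)
Lemma expR_le_quadratic (v : R) : v <= 2^-1 -> expR v <= 1 + v + 2 * v ^+ 2.
Proof.
move=> v2; have v1 : 0 < 1 - v by lra.
have : 1 - v <= expR (- v) by rewrite expR_ge1Dx.
rewrite expRN => h.
have e0 := expR_gt0 v.
have {}h : (1 - v) * expR v <= 1.
  by rewrite -[leRHS](mulVf (lt0r_neq0 e0)) ler_pM2r.
have e1 : expR v <= (1 - v)^-1 by rewrite -[leRHS]mul1r ler_pdivlMr // mulrC.
apply: (le_trans e1); rewrite -[leLHS]mul1r ler_pdivrMr //.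
have : 0 <= v ^+ 2 * (1 - 2 * v) by rewrite mulr_ge0 ?sqr_ge0 //; lra.
lra.
Qed.

Lemma mean_expR_le T (p h : T -> R) :
  finite_dist p -> (forall t, h t <= 2^-1) ->
  mean p (fun t => expR (h t)) <=
  expR (mean p h + 2 * mean p (fun t => h t ^+ 2)).
Proof.
move=> pd hb; apply: (@le_trans _ _ (mean p (fun t => 1 + h t + 2 * h t ^+ 2))).
  by apply: le_mean => // t; apply: expR_le_quadratic.
by rewrite !meanD meanZl mean_cst // -addrA expR_ge1Dx.
Qed.

Definition bounded_diff I T (c : R) (F : {ffun I -> T} -> R) :=
  forall i (x y : {ffun I -> T}),
    (forall l, l != i -> x l = y l) -> `|F x - F y| <= c.

Lemma norm_mean_le T (p F : T -> R) c :
  finite_dist p -> (forall t, `|F t| <= c) -> `|mean p F| <= c.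
Proof.
move=> pd Fc; apply: (le_trans (ler_norm_sum _ _ _)).
rewrite -[leRHS](mean_cst c pd); apply: ler_sum => t _.
by rewrite normrM ger0_norm ?pd.1 // ler_wpM2l ?pd.1.
Qed.

(** The conditional expectation of [F] given the coordinates outside [S], with the values prescribed
    by [x]. *)
Definition resample I T (p : T -> R) (S : pred I) F (x : {ffun I -> T}) : R :=
  mean (prodw p) (fun y => F (mix S y x)).

Lemma resample_bounded_diff I T (p : T -> R) (S : pred I) c (F : {ffun I -> T} -> R) :
  finite_dist p -> bounded_diff c F -> bounded_diff c (resample p S F).
Proof.
move=> pd Fc i x y xy; rewrite /resample -meanB; apply: norm_mean_le.
  exact: prodw_dist.
by move=> z; apply: (Fc i) => l li; rewrite !ffunE; case: (S l); last exact: xy.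
Qed.

(** Tower property. The case where [i] already lies in [s] is harmless: the inner resampling
    overwrites that coordinate. *)
Lemma resample_cons I T (p : T -> R) (i : I) (s : seq I) (F : {ffun I -> T} -> R) x :
  finite_dist p ->
  resample p (mem (i :: s)) F x = resample p (pred1 i) (resample p (mem s) F) x.
Proof.
move=> pd; rewrite /resample exchange_mean -(mean_mix (mem s)) //.
apply: eq_mean => z; apply: eq_mean => y; congr (F _); apply/ffunP => l.
by rewrite !ffunE /= inE; case: (l == i); case: (l \in s).
Qed.

(** One martingale step: the increment [h] is centered and bounded by [c], so [mean_expR_le] leaves
    only the quadratic term. *)
Lemma resample1_expR_le I T (p : T -> R) (i : I) c (F : {ffun I -> T} -> R) x :
  finite_dist p -> bounded_diff c F -> 0 <= c <= 2^-1 ->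
  resample p (pred1 i) (fun y => expR (F y)) x <=
  expR (resample p (pred1 i) F x + 2 * c ^+ 2).
Proof.
move=> pd Fc /andP[c0 c2]; have wd := @prodw_dist I T p pd.
set e := resample p (pred1 i) F x.
pose h y := F (mix (pred1 i) y x) - e.
have hc y : `|h y| <= c.
  rewrite /h /e /resample -(mean_cst (F (mix (pred1 i) y x)) wd) -meanB.
  apply: norm_mean_le => // z; apply: (Fc i) => l li.
  by rewrite !ffunE /= (negbTE li).
have -> : resample p (pred1 i) (fun y => expR (F y)) x =
    expR e * mean (prodw p) (fun y => expR (h y)).
  rewrite -meanZl; apply: eq_mean => y.
  by rewrite -expRD /h addrC subrK.
rewrite expRD ler_pM2l ?expR_gt0 //.
have hmean : mean (prodw p) h = 0.
  by rewrite /h meanB mean_cst // -/(resample _ _ _ _) subrr.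
apply: (le_trans (mean_expR_le wd _)).
  by move=> y; apply: le_trans c2; apply: le_trans (hc y); rewrite ler_norm.
rewrite hmean add0r ler_expR ler_pM2l //.
rewrite -[leRHS](mean_cst (c ^+ 2) wd); apply: le_mean => // y.
by rewrite -real_normK ?num_real // lerXn2r ?nnegrE.
Qed.

(** Coordinates are peeled off one at a time, each costing [2 c^2]; conditional expectations keep
    the bounded differences of [F]. *)
Lemma resample_expR_le I T (p : T -> R) (s : seq I) c (F : {ffun I -> T} -> R) x :
  finite_dist p -> bounded_diff c F -> 0 <= c <= 2^-1 ->
  resample p (mem s) (fun y => expR (F y)) x <=
  expR (resample p (mem s) F x + (size s)%:R * (2 * c ^+ 2)).
Proof.
move=> pd Fc c2; have wd := @prodw_dist I T p pd.
elim: s x => [|i s IHs] x.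
  rewrite mul0r addr0.
  have E (G : {ffun I -> T} -> R) : resample p (mem [::]) G x = G x.
    rewrite -[RHS](mean_cst (G x) wd); apply: eq_mean => y.
    by congr G; apply/ffunP => l; rewrite ffunE.
  by rewrite !E.
rewrite !resample_cons //= mulrS mulrDl mul1r addrA expRD.
apply: le_trans (_ : resample p (pred1 i) (fun y =>
    expR ((size s)%:R * (2 * c ^+ 2)) * expR (resample p (mem s) F y)) x <= _).
  by rewrite /resample; apply: le_mean => // y; rewrite -expRD addrC; exact: IHs.
rewrite /resample meanZl mulrC ler_pM2r ?expR_gt0 //.
apply: (@resample1_expR_le _ _ p i c (resample p (mem s) F) x) => //.
exact: resample_bounded_diff.
Qed.

Lemma mcdiarmid_mgf I T (p : T -> R) c (F : {ffun I -> T} -> R) :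
  finite_dist p -> bounded_diff c F -> 0 <= c <= 2^-1 ->
  mean (prodw p) (fun x => expR (F x)) <=
  expR (mean (prodw p) F + #|I|%:R * (2 * c ^+ 2)).
Proof.
move=> pd Fc c2.
(* With all coordinates resampled the base sequence is irrelevant, but one must exist; an empty [T]
   contradicts total mass one. *)
have [t _|T0] := pickP (fun _ : T => true); last first.
  by have := pd.2; rewrite big_pred0 // => /eqP; rewrite eq_sym oner_eq0.
have full (G : {ffun I -> T} -> R) :
    mean (prodw p) G = resample p (mem (enum I)) G [ffun=> t].
  apply: eq_mean => x; congr G; apply/ffunP => i.
  by rewrite ffunE /= mem_enum.
by rewrite !full cardE; apply: resample_expR_le.
Qed.


(** Coordinates outside [S] contribute the factor 1, and the bound on [t] keeps each exponent below
    1/2. Keeping the second moment [V] instead of bounding it by 1 is what exploits a sparse [f]. *)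
Lemma iid_mgf_le I T (S : pred I) (p f : T -> R) (t V : R) :
  finite_dist p -> (forall u, `|f u| <= 1) -> mean p (fun u => f u ^+ 2) <= V ->
  (0 < #|S|)%N -> `|t| <= #|S|%:R / 2 ->
  mean (prodw p) (fun x : {ffun I -> T} =>
    expR (t * (#|S|%:R^-1 * \sum_(i | S i) f (x i)))) <=
  expR (t * mean p f + 2 * t ^+ 2 / #|S|%:R * V).
Proof.
move=> pd f1 fV S0 tS; set K : R := #|S|%:R; have K0 : 0 < K by rewrite ltr0n.
pose h u := t / K * f u.
have h2 u : h u <= 2^-1.
  apply: le_trans (ler_norm _) _; rewrite normrM -[leRHS]mulr1.
  apply: ler_pM => //; rewrite normrM normfV (gtr0_norm K0).
  by rewrite ler_pdivrMr // mulrC.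
rewrite (_ : mean _ _ = mean (prodw p) (fun x : {ffun I -> T} =>
    \prod_i (fun i u => if S i then expR (h u) else 1) i (x i))); last first.
  apply: eq_mean => x; rewrite /= mulrA mulr_sumr expR_sum big_mkcond.
  by [].
rewrite (mean_prod p (fun i u => if S i then expR (h u) else 1)).
have mh : mean p (fun u => expR (h u)) <= expR (K^-1 * (t * mean p f + 2 * t ^+ 2 / K * V)).
  apply: le_trans (mean_expR_le pd h2) _; rewrite ler_expR.
  rewrite /h meanZl mulrDr; apply: lerD; first by rewrite mulrA (mulrC K^-1).
  under eq_mean do rewrite exprMn.
  rewrite meanZl.
  have -> : K^-1 * (2 * t ^+ 2 / K * V) = 2 * ((t / K) ^+ 2 * V).
    by field; rewrite lt0r_neq0.
  by rewrite ler_pM2l // ler_wpM2l // sqr_ge0.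
rewrite (_ : \prod_i _ = \prod_(i | S i) mean p (fun u => expR (h u))); last first.
  rewrite [RHS]big_mkcond; apply: eq_bigr => i _; case: (S i) => //.
  by rewrite mean_cst.
rewrite prodr_const.
apply: le_trans (_ : expR (K^-1 * (t * mean p f + 2 * t ^+ 2 / K * V)) ^+ #|S| <= _).
  apply: lerXn2r => //; rewrite nnegrE ?expR_ge0 //.
  by rewrite sumr_ge0 // => u _; rewrite mulr_ge0 ?pd.1 ?expR_ge0.
by rewrite -expRM_natl mulrA mulfV ?mul1r ?lt0r_neq0.
Qed.

(** * Elementary inequalities for separating two distributions *)

Lemma bernoulli_ineq (k : nat) (x : R) : 0 <= x <= 1 -> 1 - k%:R * x <= (1 - x) ^+ k.
Proof.
move=> /andP[x0 x1]; elim: k => [|k IHk]; first by rewrite mul0r subr0 expr0.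
rewrite exprS; apply: le_trans (_ : (1 - x) * (1 - k%:R * x) <= _); last first.
  by rewrite ler_wpM2l // subr_ge0.
have : 0 <= k%:R * x * x by rewrite !mulr_ge0.
by rewrite -natr1; lra.
Qed.

(* Factoring the difference of [a]-th powers, every summand of the cofactor is at least [1/2]. *)
Lemma hit_probability_separation (a : nat) (u v D : R) :
  0 <= u <= D -> 0 <= v <= D -> a%:R * D <= 2^-1 ->
  a%:R / 2 * (u - v) ^+ 2 <= (u - v) * ((1 - v) ^+ a - (1 - u) ^+ a).
Proof.
case: a => [|a] /andP[u0 uD] /andP[v0 vD] aD.
  by rewrite !expr0 subrr mulr0 !mul0r.
have D0 : 0 <= D by lra.
have D1 : D <= 1.
  have : 0 <= a%:R * D by rewrite mulr_ge0.
  by move: aD; rewrite -natr1; lra.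
have -> : (1 - v) ^+ a.+1 - (1 - u) ^+ a.+1 =
    (u - v) * \sum_(i < a.+1) (1 - v) ^+ (a.+1.-1 - i) * (1 - u) ^+ i.
  by rewrite subrXX; congr (_ * _); ring.
rewrite mulrA -expr2 mulrC ler_wpM2l ?sqr_ge0 //.
rewrite (_ : _ / 2 = \sum_(i < a.+1) (2^-1 : R)); last first.
  by rewrite sumr_const card_ord mulr_natl.
apply: ler_sum => i _.
have ia : (i <= a)%N by rewrite -ltnS.
apply: (@le_trans _ _ ((1 - D) ^+ a)).
  apply: le_trans (bernoulli_ineq a _); last by rewrite D0.
  by move: aD; rewrite -natr1; lra.
rewrite -[in leLHS](subnK ia) exprD.
apply: ler_pM; rewrite ?exprn_ge0 ?subr_ge0 //.
  by apply: lerXn2r; rewrite ?nnegrE; lra.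
by apply: lerXn2r; rewrite ?nnegrE; lra.
Qed.

(** Cauchy-Schwarz in tangent form: [d^2 >= 2 t |d| - t^2], summed with the optimal [t = e / m]. *)
Lemma sum_sqr_lower_bound (m : nat) (d : 'I_m -> R) (e : R) :
  (0 < m)%N -> 0 < e -> e <= \sum_j `|d j| -> e ^+ 2 / m%:R <= \sum_j d j ^+ 2.
Proof.
move=> m0 e0 he; have m0' : 0 < m%:R :> R by rewrite ltr0n.
pose t := e / m%:R; have t0 : 0 < t by rewrite divr_gt0.
apply: (@le_trans _ _ (\sum_(j < m) (2 * t * `|d j| - t ^+ 2))).
  rewrite sumrB -mulr_sumr sumr_const card_ord -[t ^+ 2 *+ m]mulr_natl.
  have -> : m%:R * t ^+ 2 = t * e by rewrite /t; field; rewrite lt0r_neq0.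
  have -> : e ^+ 2 / m%:R = t * e by rewrite /t; field; rewrite lt0r_neq0.
  have : t * e <= t * \sum_j `|d j| by rewrite ler_pM2l.
  lra.
apply: ler_sum => j _; have := sqr_ge0 (`|d j| - t).
rewrite -[d j ^+ 2]real_normK ?num_real //.
by rewrite sqrrB; lra.
Qed.

(** * Symbols occurring among the first [a] positions *)

Section Seen.
Variables (m N a : nat).
Implicit Types (x y : {ffun 'I_N -> 'I_m}) (p : 'I_m -> R).

Definition seen x (j : 'I_m) : bool := [exists i : 'I_N, (i < a)%N && (x i == j)].

Lemma seen_mix x y : seen (mix (fun i : 'I_N => (i < a)%N) x y) =1 seen x.
Proof.
move=> j; apply: eq_existsb => i.
by rewrite ffunE; case: (i < a)%N.
Qed.

(** Each of the first [a] positions accounts for at most one occurring symbol. *)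
Lemma sum_seen_le x : (a <= N)%N -> \sum_j (seen x j)%:R <= a%:R :> R.
Proof.
move=> aN.
apply: (@le_trans _ _ (\sum_j \sum_(i < N | (i < a)%N) (x i == j)%:R)).
  apply: ler_sum => j _; rewrite /seen; case: existsP => [[i /andP[ia xij]]|_]; last first.
    by rewrite sumr_ge0 // => i _.
  by rewrite (bigD1 i) //= xij lerDl sumr_ge0.
rewrite exchange_big /=.
rewrite (eq_bigr (fun=> 1)) => [|i _].
  by rewrite -(big_ord_widen _ (fun=> 1)) // sumr_const card_ord.
by rewrite (bigD1 (x i)) //= eqxx big1 ?addr0 // => j /negbTE; rewrite eq_sym => ->.
Qed.

(** Absence of [j] is an intersection of independent events, one for each position below [a]. *)
Lemma mean_seen p (j : 'I_m) : finite_dist p -> (a <= N)%N ->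
  mean (prodw p) (fun x => (seen x j)%:R) = 1 - (1 - p j) ^+ a.
Proof.
move=> pd aN.
pose h (i : 'I_N) t : R := if (i < a)%N then 1 - (t == j)%:R else 1.
rewrite (_ : mean _ _ = mean (prodw p) (fun x => 1 - \prod_i h i (x i))); last first.
  apply: eq_mean => x; rewrite /h /seen; case: existsP => [[i /andP[ia xij]]|nx].
    by rewrite (bigD1 i) //= ia xij subrr mul0r subr0.
  rewrite big1 ?subrr // => i _; case: ifP => // ia.
  case: eqP => [xij|]; last by rewrite subr0.
  by case: nx; exists i; rewrite ia xij eqxx.
rewrite meanB mean_cst; last exact: prodw_dist.
rewrite mean_prod; congr (_ - _).
have -> : \prod_i mean p (h i) = \prod_(i < N | (i < a)%N) (1 - p j).
  rewrite [RHS]big_mkcond; apply: eq_bigr => i _; rewrite /h.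
  case: ifP => _; last exact: mean_cst.
  rewrite meanB mean_cst //; congr (_ - _).
  by rewrite /mean (sum_indicatorE p); apply: eq_bigr => t _; rewrite eq_sym.
by rewrite -(big_ord_widen _ (fun=> 1 - p j)) // prodr_const card_ord.
Qed.

(** Changing one entry can affect only the occurrence of the old symbol and of the new one, each
    with weight at most [D]. *)
Lemma seen_bounded_diff (d : 'I_m -> R) (D : R) :
  (forall j, `|d j| <= D) ->
  bounded_diff (2 * D) (fun x => \sum_j d j * (seen x j)%:R).
Proof.
move=> dD i x y xy; rewrite -sumrB.
have seenE j : x i != j -> y i != j -> seen x j = seen y j.
  move=> xj yj; apply: eq_existsb => l.
  have [->|/xy -> //] := eqVneq l i.
  by rewrite (negbTE xj) (negbTE yj).
apply: le_trans (ler_norm_sum _ _ _) _.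
apply: (@le_trans _ _ (\sum_j D * ((x i == j)%:R + (y i == j)%:R))).
  apply: ler_sum => j _; rewrite -mulrBr normrM ler_pM //.
  have bool_dist (b c : bool) : `|b%:R - c%:R| <= 1 :> R.
    by case: b c => [] []; rewrite ?subrr ?subr0 ?sub0r ?normrN ?normr1 ?normr0.
  have [_|/seenE sx] := eqVneq (x i) j.
    by apply: le_trans (bool_dist _ _) _; rewrite lerDl.
  have [_|/sx ->] := eqVneq (y i) j; last by rewrite subrr normr0 addr0.
  by apply: le_trans (bool_dist _ _) _; rewrite add0r.
rewrite -mulr_sumr big_split /=.
have one (k : 'I_m) : \sum_j (k == j)%:R = 1 :> R.
  by rewrite (bigD1 k) //= eqxx big1 ?addr0 // => j /negbTE; rewrite eq_sym => ->.
by rewrite !one; lra.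
Qed.

End Seen.

(** * The split-sample statistic and its exponential moment *)

Section Statistic.
Variables (m N n : nat).
Implicit Types (x y : {ffun 'I_N -> 'I_m}) (z : {ffun 'I_n -> 'I_m}).

Let first_half (i : 'I_N) := (i < N./2)%N.
Let second_half (i : 'I_N) := (N./2 <= i)%N.

Definition score x y (j : 'I_m) : R := (seen N./2 x j)%:R - (seen N./2 y j)%:R.

(* Under (p, q, p) its expectation is half of [mean p f - mean q f]; under (p, q, q) it is the opposite. *)
Definition centered_mean (f : 'I_m -> R) x y z : R :=
  n%:R^-1 * (\sum_k f (z k)) -
  2^-1 * (#|second_half|%:R^-1 * (\sum_(i | second_half i) f (x i))) -
  2^-1 * (#|second_half|%:R^-1 * (\sum_(i | second_half i) f (y i))).

Definition statistic x y z : R := centered_mean (score x y) x y z.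

(** The score is antisymmetric, while [centered_mean] is linear in [f] and symmetric in the training
    samples. This reduces the second kind of error to the first. *)
Lemma statistic_swap x y z : statistic y x z = - statistic x y z.
Proof.
rewrite /statistic; have -> : score y x = (fun u => - score x y u).
  by apply/funext => u; rewrite /score opprB.
by rewrite /centered_mean !sumrN; ring.
Qed.

Lemma score_mixl x x' y : score (mix first_half x x') y = score x y.
Proof. by apply/funext => j; rewrite /score seen_mix. Qed.

Lemma score_mixr x y y' : score x (mix first_half y y') = score x y.
Proof. by apply/funext => j; rewrite /score seen_mix. Qed.

Lemma sum_second_half_mix (f : 'I_m -> R) x x' :
  \sum_(i | second_half i) f (mix first_half x x' i) =
  \sum_(i | second_half i) f (x' i).
Proof.
by apply: eq_bigr => i ni; rewrite ffunE /first_half ltnNge [(_ <= _)%N]ni.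
Qed.

(** The hypotheses on [F] say that it ignores the first halves of its sequences, while the score
    sees only those; [mean_split], applied to each training sample, makes the score independent of
    the data it is averaged over. *)
Lemma mean_decouple (p q r : 'I_m -> R) (F : ('I_m -> R) ->
    {ffun 'I_N -> 'I_m} -> {ffun 'I_N -> 'I_m} -> {ffun 'I_n -> 'I_m} -> R) :
  finite_dist p -> finite_dist q ->
  (forall f x x' y z, F f (mix first_half x x') y z = F f x' y z) ->
  (forall f x y y' z, F f x (mix first_half y y') z = F f x y' z) ->
  mean (prodw p) (fun x => mean (prodw q) (fun y => mean (prodw r) (fun z =>
    F (score x y) x y z))) =
  mean (prodw p) (fun x' => mean (prodw q) (fun y' =>
    mean (prodw p) (fun x => mean (prodw q) (fun y => mean (prodw r) (fun z =>
      F (score x' y') x y z))))).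
Proof.
move=> pd qd Fx Fy.
rewrite (mean_split (S := first_half) (F := fun x' x =>
    mean (prodw q) (fun y => mean (prodw r) (F (score x' y) x y)))) //; last first.
  move=> x x'; apply: eq_mean => y; apply: eq_mean => z.
  by rewrite score_mixl Fx.
apply: eq_mean => x'; rewrite -[RHS]exchange_mean; apply: eq_mean => x.
rewrite (mean_split (S := first_half) (F := fun y' y =>
    mean (prodw r) (F (score x' y') x y))) // => y y'.
by apply: eq_mean => z; rewrite score_mixr Fy.
Qed.

Lemma score_le1 x y j : `|score x y j| <= 1.
Proof.
by rewrite /score; case: (seen _ x j) (seen _ y j) => [] [];
  rewrite ?subrr ?subr0 ?sub0r ?normrN ?normr1 ?normr0.
Qed.

Lemma card_second_half : #|second_half| = (N - N./2)%N.
Proof.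
have halfN : (N./2 <= N)%N by lia.
apply/eqP; rewrite -(eqn_add2l N./2) subnKC //; apply/eqP.
rewrite -[RHS]card_ord -(cardC (mem second_half)) addnC; congr (_ + _)%N.
rewrite -[LHS]card_ord -!sum1_card (big_ord_widen _ (fun=> 1%N) halfN).
by apply: eq_bigl => i; rewrite !inE /second_half -ltnNge.
Qed.

(** The score takes values in -1, 0, 1, so its square is at most the sum of the two indicators. With
    occurrence counts this sum could be quadratic in [N]. *)
Lemma sum_score_sqr_le x y : \sum_j score x y j ^+ 2 <= N%:R.
Proof.
have halfN : (N./2 <= N)%N by lia.
apply: (@le_trans _ _ (\sum_j ((seen N./2 x j)%:R + (seen N./2 y j)%:R))).
  apply: ler_sum => j _; rewrite /score.
  by case: (seen _ x j) (seen _ y j) => [] [] /=; lra.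
rewrite big_split /= -[leRHS](subrK (N./2)%:R).
apply: lerD; last exact: sum_seen_le.
apply: le_trans (sum_seen_le _ halfN) _.
rewrite -natrB // ler_nat; lia.
Qed.

Lemma mean_score_sqr_le (p : 'I_m -> R) D x y :
  0 <= D -> (forall j, p j <= D) -> mean p (fun j => score x y j ^+ 2) <= D * N%:R.
Proof.
move=> D0 pD; apply: (@le_trans _ _ (\sum_j D * score x y j ^+ 2)).
  by apply: ler_sum => j _; rewrite ler_wpM2r ?sqr_ge0.
by rewrite -mulr_sumr; apply: ler_wpM2l (sum_score_sqr_le x y).
Qed.

(** For fixed [f] the three averages are independent, with tilts [t M / 2], [t M / 2] and [- t M].
    Their linear terms combine into the drift; the variance terms cost 1, 1 and 2 times [t^2 M V].
    The intended [M] is the minimum of [N] and [n]. *)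
Lemma conditional_mgf_le (p q f : 'I_m -> R) (V t M : R) :
  finite_dist p -> finite_dist q -> (forall j, `|f j| <= 1) ->
  mean p (fun j => f j ^+ 2) <= V -> mean q (fun j => f j ^+ 2) <= V ->
  (0 < N)%N -> (0 < n)%N -> 0 <= V -> 0 <= t <= 2^-1 -> 0 <= M -> M <= N%:R -> M <= n%:R ->
  mean (prodw p) (fun x => mean (prodw q) (fun y => mean (prodw p) (fun z =>
    expR (- (t * M) * centered_mean f x y z)))) <=
  expR (- (t * M) / 2 * (mean p f - mean q f) + 4 * t ^+ 2 * M * V).
Proof.
move=> pd qd f1 pV qV N0 n0 V0 /andP[t0 t2] M0 MN Mn.
set K : R := #|second_half|%:R.
have N2K : N%:R <= 2 * K.
  by rewrite /K card_second_half -natrM ler_nat; lia.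
have N0' : 0 < N%:R :> R by rewrite ltr0n.
have n0' : 0 < n%:R :> R by rewrite ltr0n.
have K0 : 0 < K by lra.
have tM : 0 <= t * M by rewrite mulr_ge0.
have tM2 : t * M <= M / 2 by rewrite mulrC ler_wpM2l.
have cardn : #|{: 'I_n}| = n by rewrite card_ord.
have zB := @iid_mgf_le 'I_n 'I_m predT p f (- (t * M)) V pd f1 pV.
rewrite cardn normrN ger0_norm // in zB.
have {zB} zB := zB n0 ltac:(lra).
have hB r : finite_dist r -> mean r (fun j => f j ^+ 2) <= V ->
    mean (prodw r) (fun x : {ffun 'I_N -> 'I_m} =>
      expR (t * M / 2 * (K^-1 * \sum_(i | second_half i) f (x i)))) <=
    expR (t * M / 2 * mean r f + 2 * (t * M / 2) ^+ 2 / K * V).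
  move=> rd rV; apply: iid_mgf_le => //.
    by rewrite -(ltr0n R).
  by rewrite -/K ger0_norm; lra.
rewrite (_ : mean _ _ =
    mean (prodw p) (fun x : {ffun 'I_N -> 'I_m} =>
      expR (t * M / 2 * (K^-1 * \sum_(i | second_half i) f (x i)))) *
    (mean (prodw q) (fun x : {ffun 'I_N -> 'I_m} =>
      expR (t * M / 2 * (K^-1 * \sum_(i | second_half i) f (x i)))) *
     mean (prodw p) (fun z : {ffun 'I_n -> 'I_m} =>
      expR (- (t * M) * (n%:R^-1 * \sum_k f (z k)))))); last first.
  rewrite mean_mul3; apply: eq_mean => x; apply: eq_mean => y; apply: eq_mean => z.
  by rewrite -!expRD /centered_mean -/K; congr expR; ring.
have wpos (I : finType) (r : 'I_m -> R) (F : {ffun I -> 'I_m} -> R) :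
    finite_dist r -> 0 <= mean (prodw r) (fun u => expR (F u)).
  move=> rd; apply: sumr_ge0 => u _; rewrite mulr_ge0 ?expR_ge0 //.
  by apply: (@prodw_dist I _ r rd).1.
apply: le_trans (_ : expR (t * M / 2 * mean p f + 2 * (t * M / 2) ^+ 2 / K * V) *
   (expR (t * M / 2 * mean q f + 2 * (t * M / 2) ^+ 2 / K * V) *
    expR (- (t * M) * mean p f + 2 * (- (t * M)) ^+ 2 / n%:R * V)) <= _).
  apply: ler_pM; rewrite ?mulr_ge0 ?wpos ?hB //.
  by apply: ler_pM; rewrite ?wpos ?hB.
rewrite -!expRD ler_expR.
have MK : M ^+ 2 / K <= 2 * M.
  rewrite ler_pdivrMr // expr2 (mulrC 2) -mulrA ler_wpM2l //; lra.
have Mn' : M ^+ 2 / n%:R <= M.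
  by rewrite ler_pdivrMr // expr2 ler_wpM2l.
have e1 : 2 * (t * M / 2) ^+ 2 / K * V <= t ^+ 2 * M * V.
  rewrite (_ : 2 * (t * M / 2) ^+ 2 / K * V = t ^+ 2 * V * (M ^+ 2 / K) / 2); last first.
    by field; rewrite lt0r_neq0.
  have : t ^+ 2 * V * (M ^+ 2 / K) <= t ^+ 2 * V * (2 * M).
    by rewrite ler_wpM2l // mulr_ge0 ?sqr_ge0.
  lra.
have e2 : 2 * (- (t * M)) ^+ 2 / n%:R * V <= 2 * (t ^+ 2 * M * V).
  rewrite (_ : 2 * (- (t * M)) ^+ 2 / n%:R * V = 2 * (t ^+ 2 * V * (M ^+ 2 / n%:R))); last first.
    by field; rewrite lt0r_neq0.
  have : t ^+ 2 * V * (M ^+ 2 / n%:R) <= t ^+ 2 * V * M.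
    by rewrite ler_wpM2l // mulr_ge0 ?sqr_ge0.
  lra.
lra.
Qed.

Lemma mean_score_gap (p q : 'I_m -> R) x y :
  mean p (score x y) - mean q (score x y) =
  \sum_j (p j - q j) * (seen N./2 x j)%:R - \sum_j (p j - q j) * (seen N./2 y j)%:R.
Proof.
rewrite /mean -!sumrB; apply: eq_bigr => j _; rewrite /score; ring.
Qed.

(** The differences of probabilities and of occurrence probabilities have the same sign for each
    symbol, so the contributions add up without cancellation. *)
Lemma mean_seen_gap (p q : 'I_m -> R) D :
  finite_dist p -> finite_dist q -> (forall j, p j <= D) -> (forall j, q j <= D) ->
  (N./2)%:R * D <= 2^-1 ->
  (N./2)%:R / 2 * \sum_j (p j - q j) ^+ 2 <=
  mean (prodw p) (fun x => \sum_j (p j - q j) * (seen N./2 x j)%:R) -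
  mean (prodw q) (fun y => \sum_j (p j - q j) * (seen N./2 y j)%:R).
Proof.
move=> pd qd pD qD aD; have halfN : (N./2 <= N)%N by lia.
rewrite !mean_sum -sumrB mulr_sumr; apply: ler_sum => j _.
rewrite !meanZl !mean_seen // -mulrBr.
rewrite (_ : 1 - (1 - p j) ^+ N./2 - (1 - (1 - q j) ^+ N./2) =
  (1 - q j) ^+ N./2 - (1 - p j) ^+ N./2); last by ring.
by apply: (hit_probability_separation (D := D)) => //; rewrite ?pd.1 ?qd.1 ?pD ?qD.
Qed.

(** After decoupling, the conditional drift is [g x - g y] with independent [x] and [y]; each part
    is controlled by [mcdiarmid_mgf], and [mean_seen_gap] bounds the difference of means. The 8 is 4
    from the conditional bound plus 2 from each training sample. *)
Lemma statistic_mgf_le (p q : 'I_m -> R) (D s t M : R) :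
  finite_dist p -> finite_dist q -> (forall j, p j <= D) -> (forall j, q j <= D) ->
  0 <= D -> N%:R * D <= 1 -> 0 <= s -> s <= \sum_j (p j - q j) ^+ 2 ->
  (1 < N)%N -> (0 < n)%N -> 0 <= t <= 2^-1 -> 0 <= M -> M <= N%:R -> M <= n%:R ->
  mean (prodw p) (fun x => mean (prodw q) (fun y => mean (prodw p) (fun z =>
    expR (- (t * M) * statistic x y z)))) <=
  expR (- (t * (M * N%:R) * s / 16) + 8 * t ^+ 2 * (M * N%:R) * D).
Proof.
move=> pd qd pD qD D0 ND s0 hs N1 n0 t2 M0 MN Mn.
have /andP[t0 t2'] := t2.
have half2 : (N./2 * 2 <= N)%N by clear; lia.
have half4 : (N <= 4 * N./2)%N by clear - N1; lia.
have N0 : (0 < N)%N by clear - N1; lia.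
have wp : finite_dist (@prodw 'I_N _ p) by exact: prodw_dist.
have wq : finite_dist (@prodw 'I_N _ q) by exact: prodw_dist.
rewrite (@mean_decouple p q p (fun f x y z =>
  expR (- (t * M) * centered_mean f x y z))) //; first last.
- by move=> f x y y' z; rewrite /centered_mean sum_second_half_mix.
- by move=> f x x' y z; rewrite /centered_mean sum_second_half_mix.
have V0 : 0 <= D * N%:R by rewrite mulr_ge0.
pose g x := \sum_j (p j - q j) * (seen N./2 x j)%:R.
pose E := 4 * t ^+ 2 * M * (D * N%:R).
apply: (@le_trans _ _ (mean (prodw p) (fun x => mean (prodw q) (fun y =>
    expR E * (expR (- (t * M) / 2 * g x) * expR (t * M / 2 * g y)))))).
  apply: le_mean => // x; apply: le_mean => // y.
  apply: le_trans (conditional_mgf_le pd qd (score_le1 x y)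
    (mean_score_sqr_le x y D0 pD) (mean_score_sqr_le x y D0 qD) N0 n0 V0 t2 M0 MN Mn) _.
  rewrite -!expRD ler_expR mean_score_gap -/(g x) -/(g y) /E; lra.
have -> : mean (prodw p) (fun x => mean (prodw q) (fun y =>
    expR E * (expR (- (t * M) / 2 * g x) * expR (t * M / 2 * g y)))) =
    expR E * (mean (prodw p) (fun x => expR (- (t * M) / 2 * g x)) *
              mean (prodw q) (fun y => expR (t * M / 2 * g y))).
  rewrite mean_mul -meanZl; apply: eq_mean => x.
  by rewrite -meanZl.
have dD j : `|p j - q j| <= D.
  by rewrite ler_norml; have := (pd.1 j, qd.1 j, pD j, qD j) => -[[[? ?] ?] ?]; lra.
have tM : 0 <= t * M by rewrite mulr_ge0.
(* This keeps the difference constant [t M D] below 1/2. *)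
have MD : M * D <= 1 by apply: le_trans ND; rewrite ler_wpM2r.
have MD0 : 0 <= M * D by rewrite mulr_ge0.
have c2 : 0 <= t * M * D <= 2^-1.
  rewrite -mulrA mulr_ge0 //=; apply: le_trans t2'.
  by rewrite -[leRHS]mulr1 ler_wpM2l.
have gB (u : R) : `|u| <= t * M / 2 -> bounded_diff (t * M * D) (fun x => u * g x).
  move=> uB i x y xy; rewrite -mulrBr normrM.
  rewrite (_ : t * M * D = (t * M / 2) * (2 * D)); last by field.
  apply: ler_pM => //; rewrite /g.
  exact: (seen_bounded_diff _ dD xy).
have Bx := mcdiarmid_mgf pd (gB (- (t * M) / 2) _) c2.
have By := mcdiarmid_mgf qd (gB (t * M / 2) _) c2.
rewrite card_ord meanZl in Bx; rewrite card_ord meanZl in By.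
have {}Bx := Bx ltac:(by rewrite mulNr normrN ger0_norm //; lra).
have {}By := By ltac:(by rewrite ger0_norm //; lra).
have wpos (r : 'I_m -> R) (F : {ffun 'I_N -> 'I_m} -> R) :
    finite_dist r -> 0 <= mean (prodw r) (fun u => expR (F u)).
  move=> rd; apply: sumr_ge0 => u _; rewrite mulr_ge0 ?expR_ge0 //.
  by apply: (@prodw_dist 'I_N _ r rd).1.
apply: le_trans (ler_wpM2l (expR_ge0 _) (ler_pM (wpos _ _ pd) (wpos _ _ qd) Bx By)) _.
rewrite -!expRD ler_expR.
have aD : (N./2)%:R * D <= 2^-1.
  have : (N./2)%:R * 2 * D <= N%:R * D.
    by rewrite ler_wpM2r // -natrM ler_nat.
  lra.
have a4 : N%:R <= 4 * (N./2)%:R :> R by rewrite -natrM ler_nat.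
have gap := mean_seen_gap pd qd pD qD aD.
have Ns : N%:R * s <= 4 * (N./2)%:R * \sum_j (p j - q j) ^+ 2.
  by apply: ler_pM.
rewrite -/g in gap.
have gap' : N%:R * s / 8 <= mean (prodw p) g - mean (prodw q) g by lra.
have h1 := ler_wpM2l tM gap'.
(* The spare factor [M D <= 1] brings the fluctuations of the drift down to the order of the
   conditional variance. *)
have h2 : N%:R * (t * M * D) ^+ 2 <= t ^+ 2 * M * (D * N%:R).
  rewrite (_ : N%:R * _ ^+ 2 = t ^+ 2 * M * (D * N%:R) * (M * D)); last by ring.
  by rewrite -[leRHS]mulr1 ler_wpM2l // !mulr_ge0 // sqr_ge0.
rewrite /E; lra.
Qed.

End Statistic.

Arguments statistic {m N n}.

(** * Error probabilities of the test *)

Lemma pseq_ge0 (m k : nat) (p : {ffun 'I_m -> R}) (s : seqT m k) :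
  finite_dist p -> 0 <= pseq p s.
Proof. by move=> [p0 _]; apply: prodr_ge0 => i _. Qed.

(** Chernoff: the indicator of a nonpositive statistic is at most [expR (- u * statistic x y z)]. *)
Lemma prob_event_statistic_le (m N n : nat) (p q : {ffun 'I_m -> R}) (u : R) :
  finite_dist p -> finite_dist q -> 0 <= u ->
  prob_event p q p (fun (x y : seqT m N) (z : seqT m n) => statistic x y z <= 0) <=
  mean (prodw p) (fun x : seqT m N => mean (prodw q) (fun y =>
    mean (prodw p) (fun z : seqT m n => expR (- u * statistic x y z)))).
Proof.
move=> pd qd u0; apply: ler_sum => x _; rewrite mulr_sumr.
apply: ler_sum => y _; rewrite !mulr_sumr; apply: ler_sum => z _.
rewrite -!mulrA !ler_wpM2l //.
- exact: pseq_ge0.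
- exact: pseq_ge0.
- exact: pseq_ge0.
case: (leP (statistic x y z) 0) => [st0|_] /=; last exact: expR_ge0.
by rewrite -[leLHS](@expR0 R) ler_expR mulNr -mulrN mulr_ge0 // oppr_ge0.
Qed.

(** Relabel the training samples and use [statistic_swap]. Only an inequality holds in general,
    since ties at zero count on the right alone. *)
Lemma prob_event_swap_le (m N n : nat) (p q : {ffun 'I_m -> R}) :
  finite_dist p -> finite_dist q ->
  prob_event p q q (fun (x y : seqT m N) (z : seqT m n) => ~~ (statistic x y z <= 0)) <=
  prob_event q p q (fun (x y : seqT m N) (z : seqT m n) => statistic x y z <= 0).
Proof.
move=> pd qd; rewrite /prob_event [leRHS]exchange_big /=.
apply: ler_sum => x _; apply: ler_sum => y _; apply: ler_sum => z _.
rewrite [pseq q y * pseq p x]mulrC ler_wpM2l //.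
  by rewrite !mulr_ge0 // pseq_ge0.
rewrite statistic_swap oppr_le0 -ltNge.
by case: ltP => // /ltW ->.
Qed.

Lemma avg_err_statistic_le (m N n : nat) (eps cbar : R) (p q : {ffun 'I_m -> R}) :
  0 < eps -> 0 < cbar -> N%:R / m%:R * cbar <= 1 -> (1 < N)%N -> (0 < n)%N ->
  admissible eps cbar p q ->
  avg_err (fun (x y : seqT m N) (z : seqT m n) => statistic x y z <= 0) p q <=
  expR (- (Num.min 2^-1 (eps ^+ 2 / (256 * cbar)) * eps ^+ 2 / 32) *
        ((minn (N ^ 2) (N * n))%:R / m%:R)).
Proof.
move=> e0 c0 ND N1 n0 [[p0 p1] [q0 q1] sep pD qD].
have m0 : (0 < m)%N.
  rewrite lt0n; apply/eqP => m0; subst m.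
  by move: p1; rewrite big_ord0 => /eqP; rewrite eq_sym oner_eq0.
have m0' : 0 < m%:R :> R by rewrite ltr0n.
(* The second term of the minimum makes the variance [8 t^2 M N cbar / m] at most half of the drift
   [t M N eps^2 / (16 m)]; the other half is the exponent. *)
set t := Num.min _ _.
have t0 : 0 <= t by rewrite le_min invr_ge0 ler0n divr_ge0 ?sqr_ge0 // mulr_ge0 // ltW.
have t2 : t <= 2^-1 by rewrite ge_min lexx.
have tc : t * cbar <= eps ^+ 2 / 256.
  have : t <= eps ^+ 2 / (256 * cbar) by rewrite ge_min lexx orbT.
  rewrite invfM mulrA -(ler_pM2r c0) mulfVK ?lt0r_neq0 //.
have -> : (minn (N ^ 2) (N * n))%:R = (minn N n)%:R * N%:R :> R.
  by rewrite -natrM -mulnn -minnMr mulnC.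
set M : R := (minn N n)%:R.
have MN : M <= N%:R by rewrite ler_nat geq_minl.
have Mn : M <= n%:R by rewrite ler_nat geq_minr.
have M0 : 0 <= M by [].
pose D := cbar / m%:R.
have D0 : 0 <= D by rewrite divr_ge0 // ltW.
have ND' : N%:R * D <= 1 by move: ND; rewrite /D mulrAC mulrA.
pose B := expR (- (t * (M * N%:R) * (eps ^+ 2 / m%:R) / 16) + 8 * t ^+ 2 * (M * N%:R) * D).
have s0 : 0 <= eps ^+ 2 / m%:R by rewrite divr_ge0 ?sqr_ge0.
have half_err (r s : {ffun 'I_m -> R}) : finite_dist r -> finite_dist s ->
    (forall j, r j <= D) -> (forall j, s j <= D) -> eps <= \sum_j `|r j - s j| ->
    prob_event r s r (fun (x y : seqT m N) (z : seqT m n) => statistic x y z <= 0) <= B.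
  move=> rd sd rD sD rs.
  apply: le_trans (prob_event_statistic_le _ _ rd sd (mulr_ge0 t0 M0)) _.
  apply: statistic_mgf_le => //; last by rewrite t0.
  exact: sum_sqr_lower_bound.
have pd : finite_dist p by [].
have qd : finite_dist q by [].
have err1 : prob_event p q p (fun (x y : seqT m N) (z : seqT m n) => statistic x y z <= 0) <= B.
  by apply: half_err => //; under eq_bigr do rewrite distrC.
have err2 : prob_event p q q (fun (x y : seqT m N) (z : seqT m n) => ~~ (statistic x y z <= 0)) <= B.
  by apply: le_trans (prob_event_swap_le _ _ pd qd) _; apply: half_err.
apply: (@le_trans _ _ B); first by rewrite /avg_err; lra.
rewrite ler_expR.
have : t * (M * N%:R) / m%:R * (t * cbar) <= t * (M * N%:R) / m%:R * (eps ^+ 2 / 256).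
  by apply: ler_wpM2l => //; rewrite divr_ge0 // !mulr_ge0.
rewrite /D; set i := m%:R^-1; lra.
Qed.

(** * From the finite-sample bound to the error exponent *)

Lemma limn_esup_le_near (u : nat -> \bar R) (l : \bar R) :
  (\forall k \near \oo, (u k <= l)%E) -> (limn_esup u <= l)%E.
Proof.
move=> ul; rewrite /limn_esup /limf_esup.
apply: (@le_trans _ _ (ereal_sup (u @` [set k | (u k <= l)%E]))).
  by apply: ereal_inf_lbound; exists [set k | (u k <= l)%E].
by apply: ge_ereal_sup => _ [k ukl <-].
Qed.

(** When no pair is admissible, [sup] of the empty set is 0 by convention, and [0 <= b] covers that
    case. *)
Lemma Pe_le (eps cbar b : R) (N n : nat -> nat) (phi : classifier N n) (m : nat) :
  0 <= b ->
  (forall p q, admissible eps cbar p q -> avg_err (phi m) p q <= b) ->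
  Pe eps cbar phi m <= b.
Proof.
move=> b0 phib; rewrite /Pe; set A := [set e | _]; have [A0|/set0P A0] := eqVneq A set0.
  by rewrite A0 sup0.
by apply: ge_sup => // e [p [q [adm ->]]]; apply: phib.
Qed.

(** A vanishing error probability gives minus infinity times a positive number, which is below any
    bound. *)
Lemma elog_mul_le (x c r : R) : 0 < r -> x <= expR (- c * r) ->
  (elog x * (r^-1)%:E <= (- c)%:E)%E.
Proof.
move=> r0 xc; rewrite /elog; case: (leP x 0) => [_|x0].
  by rewrite gt0_mulNye ?leNye // lte_fin invr_gt0.
rewrite -EFinM lee_fin ler_pdivrMr //.
by rewrite -[leRHS]expRK ler_ln ?posrE ?expR_gt0.
Qed.

End SplitSampleTest.

Theorem theorem2 (R : realType) (eps cbar : R) (N n : nat -> nat) :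
  0 < eps -> 0 < cbar ->
  (fun m => (N m)%:R : R) @ \oo --> +oo ->
  (fun m => (n m)%:R : R) @ \oo --> +oo ->
  (fun m => (N m)%:R / m%:R : R) @ \oo --> 0 ->
  (fun m => (n m)%:R / m%:R : R) @ \oo --> 0 ->
  (fun m => m%:R / (minn (N m ^ 2) (N m * n m))%:R : R) @ \oo --> 0 ->
  exists phi : classifier N n, (0 < J eps cbar phi)%E.
Proof.
move=> e0 c0 Noo noo Nm _ _.
(* The statistic has positive drift when the test sample follows [pi], so a nonpositive value
   decides for [mu]. *)
exists (fun m (x y : seqT m (N m)) (z : seqT m (n m)) => @statistic R _ _ _ x y z <= 0).
pose c := Num.min 2^-1 (eps ^+ 2 / (256 * cbar)) * eps ^+ 2 / 32.
have cpos : 0 < c.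
  by rewrite !mulr_gt0 ?exprn_gt0 // lt_min invr_gt0 ltr0n divr_gt0 ?exprn_gt0 // mulr_gt0.
apply: (@lt_le_trans _ _ c%:E); first by rewrite lte_fin.
rewrite /J leeNr -EFinN; apply: limn_esup_le_near.
have N2 : \forall m \near \oo, 2 <= (N m)%:R :> R by move/cvgryPge: Noo; apply.
have n1 : \forall m \near \oo, 1 <= (n m)%:R :> R by move/cvgryPge: noo; apply.
(* This is where [N = o(m)] enters: it yields [N cbar / m <= 1], the regime where occurrence
   probabilities are nearly linear. *)
have Ns : \forall m \near \oo, `|(N m)%:R / m%:R| < cbar^-1 :> R.
  by move/cvgr0Pnorm_lt: Nm; apply; rewrite invr_gt0.
near=> m.
have m0 : (0 < m)%N by near: m; exists 1%N.
have N1 : (1 < N m)%N by rewrite -(ler_nat R); near: m; exact: N2.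
have n0 : (0 < n m)%N by rewrite -(ler_nat R); near: m; exact: n1.
have Nc : (N m)%:R / m%:R * cbar <= 1 :> R.
  rewrite -ler_pdivlMr // div1r ltW //; apply: le_lt_trans (ler_norm _) _.
  by near: m; exact: Ns.
apply: elog_mul_le.
  by rewrite divr_gt0 ?ltr0n // leq_min expn_gt0 muln_gt0 n0 (ltnW N1).
apply: Pe_le; first exact: expR_ge0.
by move=> p q adm; apply: avg_err_statistic_le adm.
Unshelve. all: by end_near.
Qed.
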